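(* Let $m,n$ be positive integers and let $A\in H_m$ and $B\in H_n$. Then the Cayley transform $U_{A\otimes B}$ of $A\otimes B$ can be written as $C\otimes D$ for some $C\in M_m$ and $D\in M_n$ if and only if one of the following conditions is fulfilled: (a) $A$ has one eigenvalue; (b) $B$ has one eigenvalue; (c) $A$ has two eigenvalues $a_1,a_2$ and $B$ has two eigenvalues $b_1,b_2$ such that $a_1b_1a_2b_2=1$.
   Context: $M_n$ denotes the algebra of $n\times n$ complex matrices, $H_n\subset M_n$ the set of Hermitian matrices, $I_n$ the $n\times n$ identity matrix, and $\otimes$ the Kronecker product. For a Hermitian matrix $X\in H_k$ (any $k$), the Cayley transform of $X$ is the unitary matrix $U_X=(X-iI_k)(X+iI_k)^{-1}$. The phrases ''has one eigenvalue'' and ''has two eigenvalues'' mean exactly one, respectively exactly two, distinct eigenvalues (multiplicities are not counted). *)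

(* Defs.v *)
From mathcomp Require Import all_boot all_order all_algebra.
From mathcomp Require Import complex mxtens reals.

Set Implicit Arguments.
Unset Strict Implicit.
Unset Printing Implicit Defensive.

Import Order.TTheory GRing.Theory Num.Theory.

Local Open Scope ring_scope.
Local Open Scope complex_scope.

(* For Hermitian X the matrix X + 'i%:M is invertible, so the convention
   invmx A = A for singular A is never used. *)
Definition cayley (R : realType) (k : nat) (X : 'M[R[i]]_k) : 'M[R[i]]_k :=
  (X - ('i%C)%:M) *m invmx (X + ('i%C)%:M).

(* Eigenvalues are counted without multiplicity. *)
Definition one_eigenvalue (R : realType) (k : nat) (X : 'M[R[i]]_k) : Prop :=
  exists x : R[i], eigenvalue X =1 pred1 x.

Definition two_eigenvalues (R : realType) (k : nat) (X : 'M[R[i]]_k)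
    (x1 x2 : R[i]) : Prop :=
  x1 != x2 /\ eigenvalue X =1 pred2 x1 x2.

(* Main.v *)
Require Import Defs.
From mathcomp Require Import all_boot all_order all_algebra.
From mathcomp Require Import complex mxtens reals.
From mathcomp Require Import ring.

(** Diagonalise [A] and [B] unitarily, with real eigenvalues [a_i] and [b_k];
    the Cayley transform of [A *t B] becomes diagonal with entries
    [F i k = f (a_i b_k)], [f x = (x - i) / (x + i)], and it is a Kronecker
    product iff the nonvanishing matrix [F] has rank one, i.e.
    [F i k * F j l = F i l * F j k] throughout.  Clearing denominators, this
    identity says [(a_i - a_j) (b_k - b_l) (a_i a_j b_k b_l - 1) = 0].  If
    neither [A] nor [B] has a single eigenvalue, any two distinct values of
    [b] thus have the same nonzero product [(a_i a_j)^-1], which leaves room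
    for only two of them; likewise for [a]. *)

Import Order.TTheory GRing.Theory Num.Theory.
Local Open Scope ring_scope.
Local Open Scope complex_scope.

Definition cayley_fun {R : realType} (x : R[i]) : R[i] := (x - 'i%C) / (x + 'i%C).

Section CayleyFun.

Variable R : realType.
Implicit Types x y z w : R[i].

(** A vanishing sum would make ['i%C] real, yet its square is -1 and real numbers have nonnegative
    squares. *)
Lemma real_addi_neq0 x : x \is Num.real -> x + 'i%C != 0.
Proof.
move=> xr; apply: contraTneq xr => /eqP; rewrite addr_eq0 => /eqP->.
by rewrite rpredN Num.Theory.realEsqr sqr_i ler0N1.
Qed.

Lemma real_subi_neq0 x : x \is Num.real -> x - 'i%C != 0.
Proof.
by move=> xr; rewrite -oppr_eq0 opprB addrC -[x]opprK real_addi_neq0 ?rpredN.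
Qed.

Lemma cayley_fun_neq0 x : x \is Num.real -> cayley_fun x != 0.
Proof.
by move=> xr; rewrite mulf_neq0 ?invr_eq0 ?real_addi_neq0 ?real_subi_neq0.
Qed.

Lemma cayley_fun_cross x y z w :
    x \is Num.real -> y \is Num.real -> z \is Num.real -> w \is Num.real ->
  (cayley_fun (x * z) * cayley_fun (y * w) ==
   cayley_fun (x * w) * cayley_fun (y * z)) =
  [|| x == y, z == w | x * y * z * w == 1].
Proof.
move=> xr yr zr wr; rewrite /cayley_fun !mulf_div.
rewrite eqr_div ?mulf_neq0 ?real_addi_neq0 ?rpredM // -subr_eq0.
have i2 := sqr_i R.
(* The factorisation holds only modulo ['i%C ^+ 2 = -1]; [i3] lets [ring] reduce cubic powers as
   well. *)
have -> : (x * z - 'i%C) * (y * w - 'i%C) * ((x * w + 'i%C) * (y * z + 'i%C)) -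
  (x * w - 'i%C) * (y * z - 'i%C) * ((x * z + 'i%C) * (y * w + 'i%C)) =
  - (2%:R * 'i%C) * ((x - y) * ((z - w) * (x * y * z * w - 1))) :> R[i].
  have i3 : 'i%C ^+ 3 = - 'i%C :> R[i] by rewrite exprS i2 mulrN1.
  by ring: i2 i3.
rewrite !mulf_eq0 oppr_eq0 !mulf_eq0 pnatr_eq0 /= !subr_eq0.
suff -> : ('i%C == 0 :> R[i]) = false by [].
by rewrite -sqrf_eq0 i2 oppr_eq0 oner_eq0.
Qed.

End CayleyFun.

Section Diagonal.

Set Implicit Arguments.
Unset Strict Implicit.

Variable R : realType.
Local Notation C := R[i].

(** Eigenvectors are rows here: [v] goes to [v *m S], an eigenvector of [diag_mx d], and any nonzero
    coordinate of it pins [x] down. Conversely, row [i] of [T] has eigenvalue [d 0 i]. *)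
Lemma eigenvalue_diag_conj n (S T : 'M[C]_n) (d : 'rV[C]_n) x :
  T *m S = 1%:M ->
  reflect (exists i, x = d 0 i) (eigenvalue (S *m diag_mx d *m T) x).
Proof.
move=> TS; have ST := mulmx1C TS.
apply: (iffP eigenvalueP) => [[v vA v0] | [i ->]].
  have w0 : v *m S != 0.
    by apply: contraNneq v0 => vS; rewrite -[v]mulmx1 -ST mulmxA vS mul0mx.
  have /rV0Pn[i wi] := w0; exists i.
  move/(congr1 (fun u => (u *m S) 0 i)): vA.
  rewrite !mulmxA -(mulmxA _ T S) TS mulmx1 mul_mx_diag -scalemxAl !mxE.
  by rewrite mulrC => /(mulIf _)->; rewrite // mxE in wi.
exists (delta_mx 0 i *m T).
  rewrite !mulmxA -(mulmxA _ T S) TS mulmx1.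
  by rewrite -mulmxA -!rowE row_mul row_diag_mx -scalemxAl -rowE.
apply/eqP => /(congr1 (mulmx^~ S)); rewrite -mulmxA TS mulmx1 mul0mx.
by move/matrixP/(_ 0 i)/eqP; rewrite !mxE !eqxx oner_eq0.
Qed.

(** Since [T] inverts [S], conjugation respects scalar shifts, products and inverses, so everything
    happens entrywise on [d]. Realness keeps the entries [d 0 j + 'i%C] nonzero, hence
    invertible. *)
Lemma cayley_diag_conj n (S T : 'M[C]_n) (d : 'rV[C]_n) :
    T *m S = 1%:M -> (forall i, d 0 i \is Num.real) ->
  cayley (S *m diag_mx d *m T) = S *m diag_mx (map_mx cayley_fun d) *m T.
Proof.
move=> TS dr; have ST := mulmx1C TS.
have shift a : S *m diag_mx d *m T + a%:M = S *m diag_mx (d + const_mx a) *m T.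
  rewrite linearD /= diag_const_mx mulmxDr mulmxDl.
  by rewrite mul_mx_scalar -scalemxAl ST scalemx1.
have mulST (e f : 'rV[C]_n) :
    S *m diag_mx e *m T *m (S *m diag_mx f *m T) =
    S *m diag_mx (\row_j (e 0 j * f 0 j)) *m T.
  by rewrite !mulmxA -(mulmxA _ T S) TS mulmx1 -[S *m _ *m _]mulmxA mulmx_diag.
have inv (e : 'rV[C]_n) : (forall j, e 0 j != 0) ->
    invmx (S *m diag_mx e *m T) = S *m diag_mx (\row_j (e 0 j)^-1) *m T.
  move=> e0; have h : S *m diag_mx e *m T *m
      (S *m diag_mx (\row_j (e 0 j)^-1) *m T) = 1%:M.
    rewrite mulST (_ : \row_j _ = const_mx 1).
      by rewrite diag_const_mx mulmx1.
    by apply/rowP => j; rewrite !mxE divff.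
  by rewrite -[RHS]mul1mx -(mulVmx (mulmx1_unit h).1) -(mulmxA (invmx _)) h mulmx1.
rewrite /cayley -raddfN /= !shift inv => [|j].
  rewrite mulST; congr (_ *m diag_mx _ *m _).
  by apply/rowP => j; rewrite !mxE.
by rewrite !mxE real_addi_neq0.
Qed.

Lemma diag_mx_tensP m n (F : 'I_m -> 'I_n -> C) :
    (0 < m)%N -> (0 < n)%N -> (forall i k, F i k != 0) ->
  (exists (X : 'M_m) (Y : 'M_n),
     diag_mx (\row_p F (mxtens_unindex p).1 (mxtens_unindex p).2) = X *t Y) <->
  (forall i j k l, F i k * F j l = F i l * F j k).
Proof.
move=> m0 n0 F0; split=> [[X [Y XY]] i j k l | cross].
  have FE i' k' : F i' k' = X i' i' * Y k' k'.
    by rewrite -tensmxE -XY !mxE eqxx mulr1n mxtens_indexK.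
  by rewrite !FE; ring.
pose i0 := Ordinal m0; pose k0 := Ordinal n0.
(* A rank one [F] is its column [k0] times its row [i0], divided by their common entry [F i0 k0]. *)
exists (diag_mx (\row_i F i k0)), (diag_mx (\row_k (F i0 k / F i0 k0))).
apply/matrixP => p q.
case: (mxtens_indexP p) => i k; case: (mxtens_indexP q) => j l.
rewrite tensmxE !mxE !mxtens_indexK /= (can_eq (@mxtens_indexK _ _)) xpair_eqE.
case: eqVneq => [_|_]; last by rewrite mul0r.
case: eqVneq => [_|_]; last by rewrite mulr0.
by rewrite !mulr1n mulrA [in RHS](mulrC (F i k0)) (cross i0 i) mulrAC divff ?mul1r.
Qed.

Lemma hermsymmx_diag_conj n (A : 'M[C]_n) : A \is hermsymmx ->
  exists S T (d : 'rV[C]_n),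
    [/\ T *m S = 1%:M, forall i, d 0 i \is Num.real & A = S *m diag_mx d *m T].
Proof.
move=> hA; exists (invmx (spectralmx A)), (spectralmx A), (spectral_diag A).
split; first by rewrite mulmxV ?spectral_unit.
  by move=> i; have /mxOverP := hermitian_spectral_diag_real hA; apply.
exact/orthomx_spectralP/hermitian_normalmx.
Qed.

Lemma tens1mx1 m n : 1%:M *t 1%:M = 1%:M :> 'M[C]_(m * n).
Proof.
apply/matrixP => p q.
case: (mxtens_indexP p) => i k; case: (mxtens_indexP q) => j l.
rewrite tensmxE !mxE (can_eq (@mxtens_indexK _ _)) xpair_eqE.
by rewrite -natrM mulnb.
Qed.

Lemma tens_diag_mx m n (d : 'rV[C]_m) (e : 'rV[C]_n) :
  diag_mx d *t diag_mx e =
  diag_mx (\row_p (d 0 (mxtens_unindex p).1 * e 0 (mxtens_unindex p).2)).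
Proof.
apply/matrixP => p q.
case: (mxtens_indexP p) => i k; case: (mxtens_indexP q) => j l.
rewrite tensmxE !mxE !mxtens_indexK /= (can_eq (@mxtens_indexK _ _)) xpair_eqE.
case: eqVneq => [_|_]; last by rewrite mul0r.
by case: eqVneq => [_|_]; rewrite ?mulr0.
Qed.

(** [S *t S'] diagonalises the tensor product. Conjugation by it acts on each factor separately, so
    being a Kronecker product can be tested on the diagonal form. *)
Lemma cayley_tensP m n (S T : 'M[C]_m) (a : 'rV[C]_m) (S' T' : 'M[C]_n)
    (b : 'rV[C]_n) :
    (0 < m)%N -> (0 < n)%N -> T *m S = 1%:M -> T' *m S' = 1%:M ->
    (forall i, a 0 i \is Num.real) -> (forall k, b 0 k \is Num.real) ->
  (exists (X : 'M_m) (Y : 'M_n),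
     cayley ((S *m diag_mx a *m T) *t (S' *m diag_mx b *m T')) = X *t Y) <->
  (forall i j k l,
     [|| a 0 i == a 0 j, b 0 k == b 0 l | a 0 i * a 0 j * b 0 k * b 0 l == 1]).
Proof.
move=> m0 n0 TS TS' ar br.
have TTSS : (T *t T') *m (S *t S') = 1%:M by rewrite tensmx_mul TS TS' tens1mx1.
rewrite -!tensmx_mul tens_diag_mx cayley_diag_conj //; last first.
  by move=> p; rewrite mxE rpredM.
pose F i k := cayley_fun (a 0 i * b 0 k).
have -> : map_mx cayley_fun
    (\row_p (a 0 (mxtens_unindex p).1 * b 0 (mxtens_unindex p).2)) =
    \row_p F (mxtens_unindex p).1 (mxtens_unindex p).2.
  by apply/rowP => p; rewrite !mxE.
have F0 i k : F i k != 0 by rewrite cayley_fun_neq0 ?rpredM.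
have crossP i j k l : reflect (F i k * F j l = F i l * F j k)
    [|| a 0 i == a 0 j, b 0 k == b 0 l | a 0 i * a 0 j * b 0 k * b 0 l == 1].
  by rewrite -cayley_fun_cross //; apply: eqP.
split=> [[X [Y XY]] i j k l | cross].
  apply/crossP; move: i j k l; apply/(diag_mx_tensP m0 n0 F0).
  exists (T *m X *m S), (T' *m Y *m S').
  by rewrite -!tensmx_mul -XY !mulmxA TTSS mul1mx -mulmxA TTSS mulmx1.
have /(diag_mx_tensP m0 n0 F0)[X [Y ->]] :
    forall i j k l, F i k * F j l = F i l * F j k.
  by move=> i j k l; apply/crossP.
by exists (S *m X *m T), (S' *m Y *m T'); rewrite !tensmx_mul.
Qed.

End Diagonal.

Theorem theorem2p3 (R : realType) (m n : nat) (hm : (0 < m)%N) (hn : (0 < n)%N)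
    (A : 'M[R[i]]_m) (B : 'M[R[i]]_n)
    (hA : A \is hermsymmx) (hB : B \is hermsymmx) :
  (exists (C : 'M[R[i]]_m) (D : 'M[R[i]]_n), cayley (A *t B) = C *t D) <->
  (one_eigenvalue A
   \/ one_eigenvalue B
   \/ exists a1 a2 b1 b2 : R[i],
        [/\ two_eigenvalues A a1 a2, two_eigenvalues B b1 b2
          & a1 * b1 * a2 * b2 = 1]).
Proof.
have [S [T [a [TS ar defA]]]] := hermsymmx_diag_conj hA.
have [S' [T' [b [TS' br defB]]]] := hermsymmx_diag_conj hB.
have eigA x : reflect (exists i, x = a 0 i) (eigenvalue A x).
  by rewrite defA; apply: eigenvalue_diag_conj.
have eigB x : reflect (exists k, x = b 0 k) (eigenvalue B x).
  by rewrite defB; apply: eigenvalue_diag_conj.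
rewrite {1}defA {1}defB.
apply: (iff_trans (cayley_tensP hm hn TS TS' ar br)).
pose i0 := Ordinal hm; pose k0 := Ordinal hn.
split=> [cross | ].
  have [/forallP constA|/forallPn[i aii0]] := boolP [forall i, a 0 i == a 0 i0].
    left; exists (a 0 i0) => x; apply/eigA/eqP => [[i ->]|->]; last by exists i0.
    exact/eqP/constA.
  have [/forallP constB|/forallPn[k bkk0]] := boolP [forall k, b 0 k == b 0 k0].
    right; left; exists (b 0 k0) => x; apply/eigB/eqP => [[k ->]|->].
      exact/eqP/constB.
    by exists k0.
  right; right; exists (a 0 i), (a 0 i0), (b 0 k), (b 0 k0).
  have prod1 := cross i i0 k k0.
  rewrite (negPf aii0) (negPf bkk0) /= in prod1; move/eqP: prod1 => prod1.
  (* A product equal to 1 has nonzero factors; this permits the cancellations below. *)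
  have : a 0 i * a 0 i0 * b 0 k * b 0 k0 != 0 by rewrite prod1 oner_neq0.
  rewrite !mulf_eq0 !negb_or.
  move=> /andP[/andP[/andP[ai_neq0 ai0_neq0] bk_neq0] bk0_neq0].
  split; last by rewrite -prod1; ring.
    split=> // x; apply/eigA/orP; last first.
      by move=> [] /eqP ->; [exists i | exists i0].
    (* If [a 0 p] differs from [a 0 i], the pair [i], [p] also gives product 1 with the same [b]
       values; cancelling against [prod1] forces [a 0 p = a 0 i0]. *)
    move=> [p ->]; have [->|pi] := eqVneq (a 0 p) (a 0 i); [by left | right].
    have := cross i p k k0; rewrite eq_sym (negPf pi) (negPf bkk0) /= -prod1.
    by move/eqP/(mulIf bk0_neq0)/(mulIf bk_neq0)/(mulfI ai_neq0)->.
  split=> // x; apply/eigB/orP; last first.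
    by move=> [] /eqP ->; [exists k | exists k0].
  move=> [q ->]; have [->|qk] := eqVneq (b 0 q) (b 0 k); [by left | right].
  have := cross i i0 k q; rewrite (negPf aii0) eq_sym (negPf qk) /= -prod1.
  by move/eqP/(mulfI (mulf_neq0 (mulf_neq0 ai_neq0 ai0_neq0) bk_neq0))->.
move=> [[x eigAx]|[[y eigBy]|
  [a1 [a2 [b1 [b2 [[_ eigA12] [_ eigB12] prod1]]]]]]] i j k l.
- have ax p : a 0 p = x by apply/eqP; rewrite -[_ == _]eigAx; apply/eigA; exists p.
  by rewrite !ax eqxx.
- have bx p : b 0 p = y by apply/eqP; rewrite -[_ == _]eigBy; apply/eigB; exists p.
  by rewrite !bx eqxx orbT.
have a12 p : (a 0 p == a1) || (a 0 p == a2).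
  by rewrite -[_ || _]eigA12; apply/eigA; exists p.
have b12 q : (b 0 q == b1) || (b 0 q == b2).
  by rewrite -[_ || _]eigB12; apply/eigB; exists q.
(* The cases that survive have both [a] values and both [b] values present, so the product is
   [a1 * b1 * a2 * b2] up to order. *)
case/orP: (a12 i) => /eqP->; case/orP: (a12 j) => /eqP->; rewrite ?eqxx //;
case/orP: (b12 k) => /eqP->; case/orP: (b12 l) => /eqP->; rewrite ?eqxx ?orbT //;
by apply/or3P/Or33/eqP; rewrite -prod1; ring.
Qed.
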